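(* Suppose that $f:U\to\mathbb{R}$ is a twice continuously (Fr\'echet) differentiable function defined on an open and convex subset $U$ of some real normed space $(X,\|\cdot\|)$, $X\neq\{0\}$. Suppose that $C$ is a convex subset of $X$ such that $C\cap U\neq\emptyset$. Assume that $f''$ is bounded and uniformly continuous on bounded subsets of $C\cap U$. Fix an arbitrary $y_0\in C\cap U$, and let $s:=\sup\{\|f''(x)\|:x\in C\cap U\}$ and $s_0:=\|f''(y_0)\|$. If $s=\infty$, then for each strictly increasing sequence $(\lambda_k)_{k=1}^{\infty}$ of positive numbers which satisfies $\lambda_1>s_0$ and $\lim_{k\to\infty}\lambda_k=\infty$, there exists an increasing sequence $(S_k)_{k=1}^{\infty}$ of bounded and convex subsets of $C$ (and also closed if $C$ is closed) which satisfies the following properties: first, $S_k\cap U\neq\emptyset$ for all $k\in\mathbb{N}$; second, $\bigcup_{k=1}^{\infty}S_k=C$; third, for each $k\in\mathbb{N}$, the function $f'$ is Lipschitz continuous on $S_k\cap U$ with $\lambda_k$ as a Lipschitz constant; moreover, if $C$ contains more than one point, then also $S_k\cap U$ contains more than one point for each $k\in\mathbb{N}$. Finally, if $s<\infty$, then $f'$ is Lipschitz continuous on $C\cap U$ with $s$ as a Lipschitz constant.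
   Context: Here $f':U\to X^*$ and $f'':U\to\mathcal{L}(X,X^* )$ are the first and second Fr\'echet derivatives, with the dual norm and the operator norm respectively; $\|f''(x)\|$ is the operator norm. ''Bounded and uniformly continuous on bounded subsets of $C\cap U$'' means that on each bounded subset of $C\cap U$ the mapping $f''$ is bounded and uniformly continuous. A sequence of sets $(S_k)$ is increasing if $S_k\subseteq S_{k+1}$ for all $k$. *)

(* Defs.v *)
From HB Require Import structures.
From mathcomp Require Import all_boot all_order all_algebra.
From mathcomp Require Import all_classical all_reals all_analysis.

Set Implicit Arguments.
Unset Strict Implicit.
Unset Printing Implicit Defensive.

Import Order.TTheory GRing.Theory Num.Theory.
Import numFieldNormedType.Exports.

Local Open Scope classical_set_scope.
Local Open Scope ring_scope.

Section ContinuousLinear.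
Context {R : realType} {V W : normedModType R}.

Definition is_contlin : {pred V -> W} :=
  [pred g : V -> W | `[< linear g /\ continuous g >]].

Lemma is_contlinP (g : V -> W) :
  reflect (linear g /\ continuous g) (g \in is_contlin).
Proof. exact: asboolP. Qed.

Fact is_contlin_submod : submod_closed is_contlin.
Proof.
split.
  apply/is_contlinP; split; last by move=> x; exact: cvg_cst.
  by move=> a x y; rewrite /= scaler0 addr0.
move=> a g h /is_contlinP[lg cg] /is_contlinP[lh ch]; apply/is_contlinP; split.
  move=> k x y; rewrite /= !fctE lg lh !scalerDr !scalerA (mulrC a k).
  by rewrite addrACA.
by move=> x; apply: cvgD; [apply: cvgZl_tmp; exact: cg|exact: ch].
Qed.

HB.instance Definition _ :=
  GRing.isSubmodClosed.Build R (V -> W) is_contlin is_contlin_submod.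

End ContinuousLinear.

Section NormedSpaceOfOperators.
Context {R : realType} (V W : normedModType R).

Record contlin := ContLin {
  contlin_fun :> V -> W;
  contlin_prop : contlin_fun \in is_contlin }.

HB.instance Definition _ := [isSub for contlin_fun].
HB.instance Definition _ := [Choice of contlin by <:].
HB.instance Definition _ := [SubChoice_isSubLmodule of contlin by <:].


Lemma contlin_linear (g : contlin) : linear g.
Proof. by have /is_contlinP[] := contlin_prop g. Qed.

Lemma contlin_continuous (g : contlin) : continuous g.
Proof. by have /is_contlinP[] := contlin_prop g. Qed.

HB.instance Definition _ (g : contlin) :=
  GRing.isLinear.Build R V W _ g (contlin_linear g).

Definition opnorm (g : contlin) : R := sup [set `|g x| | x in [set x | `|x| <= 1]].

Lemma opnorm_has_sup (g : contlin) :
  has_sup [set `|g x| | x in [set x : V | `|x| <= 1]].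
Proof.
split; first by exists `|g 0|, 0 => //=; rewrite normr0.
have /linear_bounded_continuous/linear_boundedP[M [Mr gM]] :=
  @contlin_continuous g.
exists (`|M| + 1) => _ [x /= x1 <-].
have M1 : M < `|M| + 1 by rewrite (le_lt_trans (ler_norm M))// ltrDl.
apply: (le_trans (gM _ M1 x)).
by rewrite ler_piMr// addr_ge0.
Qed.

Lemma opnorm_le1 (g : contlin) x : `|x| <= 1 -> `|g x| <= opnorm g.
Proof.
by move=> x1; apply: ub_le_sup; [have [] := opnorm_has_sup g|exists x].
Qed.

Lemma opnorm_ge0 (g : contlin) : 0 <= opnorm g.
Proof.
by rewrite (le_trans (normr_ge0 (g 0)))// opnorm_le1// normr0.
Qed.

Lemma opnorm_leP (g : contlin) M :
  (forall x, `|x| <= 1 -> `|g x| <= M) -> opnorm g <= M.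
Proof.
move=> gM; apply: ge_sup; first by have [] := opnorm_has_sup g.
by move=> _ [x /= x1 <-]; exact: gM.
Qed.

Lemma ler_opnorm (g : contlin) x : `|g x| <= opnorm g * `|x|.
Proof.
have [->|x0] := eqVneq x 0; first by rewrite linear0 !normr0 mulr0.
have nx0 : 0 < `|x| by rewrite normr_gt0.
rewrite -ler_pdivrMr// mulrC -[X in X * _]gtr0_norm ?invr_gt0// -normrZ -linearZ.
by apply: opnorm_le1; rewrite normrZ gtr0_norm ?invr_gt0// mulVf ?gt_eqF.
Qed.

Fact ler_opnormD (g h : contlin) : opnorm (g + h) <= opnorm g + opnorm h.
Proof.
apply: opnorm_leP => x x1.
by rewrite (le_trans (ler_normD _ _))// lerD// opnorm_le1.
Qed.

Fact opnormZ (a : R) (g : contlin) : opnorm (a *: g) = `|a| * opnorm g.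
Proof.
have leZ (b : R) (h : contlin) : opnorm (b *: h) <= `|b| * opnorm h.
  apply: opnorm_leP => x x1.
  by rewrite [X in `|X|](_ : _ = b *: h x)// normrZ ler_wpM2l// opnorm_le1.
apply/eqP; rewrite eq_le leZ/=.
have [->|a0] := eqVneq a 0; first by rewrite normr0 mul0r opnorm_ge0.
rewrite -ler_pdivlMl ?normr_gt0// -normfV.
by rewrite -[in leLHS](scalerK a0 g) leZ.
Qed.

Fact opnorm_eq0 (g : contlin) : opnorm g = 0 -> g = 0.
Proof.
move=> g0; apply: val_inj; apply/funext => x /=.
by apply/normr0_eq0/le_anti; rewrite normr_ge0 (le_trans (ler_opnorm _ _))// g0 mul0r.
Qed.

HB.instance Definition _ :=
  Lmodule_isNormed.Build R contlin ler_opnormD opnormZ opnorm_eq0.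

Lemma contlin_normE (g : contlin) : `|g| = opnorm g.
Proof. by []. Qed.

End NormedSpaceOfOperators.

Section FrechetDerivative.
Context {R : realType} {V W : normedModType R}.

(* The library's differential ['d f x] as a point of the normed space
   [contlin V W].  The default value 0 is only used where ['d f x] is not
   continuous, hence never where [f] is differentiable. *)
Definition frechet (f : V -> W) (x : V) : contlin V W :=
  insubd (0 : contlin V W) ('d f x : V -> W).

Lemma frechetE (f : V -> W) (x : V) :
  differentiable f x -> frechet f x = 'd f x :> (V -> W).
Proof.
move=> df; rewrite /frechet; apply: insubdK; apply/is_contlinP; split.
  exact: linearP.
exact: diff_continuous.
Qed.

End FrechetDerivative.

Definition C2_on {R : realType} {V W : normedModType R} (f : V -> W) (U : set V) :=
  [/\ forall x, U x -> differentiable f x,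
      forall x, U x -> differentiable (frechet f) x &
      forall x, U x -> {for x, continuous (frechet (frechet f))}].

(* [subspace A] is the carrier of [X] with the uniformity induced on [A]. *)
Definition unif_continuous_on {R : realType} {V W : normedModType R}
  (A : set V) (g : V -> W) := @unif_continuous (subspace A) W g.

Lemma unif_continuous_onP {R : realType} {V W : normedModType R}
    (A : set V) (g : V -> W) :
  unif_continuous_on A g <->
  forall e, 0 < e -> exists2 d, 0 < d &
    forall x y, A x -> A y -> `|x - y| < d -> `|g x - g y| < e.
Proof.
rewrite /unif_continuous_on unif_continuousP; split => gA e e0.
  have [d d0 gd] := gA _ e0; exists d => // x y Ax Ay xyd.
  suff : ball (g x) e (g y) by rewrite -ball_normE.
  apply: (gd (x, y)); rewrite /ball/= /subspace_ball mem_set//; split => //.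
  by rewrite -ball_normE.
have [d d0 gd] := gA _ e0; exists d => // -[x y] xy.
suff : `|g x - g y| < e by rewrite -ball_normE.
move: xy; rewrite {1}/ball/= /subspace_ball.
case: ifPn => [/set_mem Ax [Ay]|_ ->]; last by rewrite subrr normr0.
by rewrite -ball_normE/=; exact: gd.
Qed.

(* Main.v *)
Require Import Defs.
From HB Require Import structures.
From mathcomp Require Import all_boot all_order all_algebra.
From mathcomp Require Import all_classical all_reals all_analysis.

Set Implicit Arguments.
Unset Strict Implicit.
Unset Printing Implicit Defensive.

Import Order.TTheory GRing.Theory Num.Theory.
Import numFieldNormedType.Exports.

Local Open Scope classical_set_scope.
Local Open Scope ring_scope.

(** Everything reduces to one Lipschitz criterion and one choice of sets.

    The criterion is the mean value inequality [contlin_mean_value]: on a convex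
    set where [`|f''|] is at most [L], the map [f'] is [L]-Lipschitz.  It settles
    the case of a finite supremum at once.

    When the supremum is infinite, call a point [z] of [C `&` U] bad for [k] if
    [lam k < `|f'' z|].  Let [S k] consist of the points of [C] that are at
    distance at most [k + 1] from [y0] and no farther from [y0] than any bad
    point.  This is [C] intersected with closed balls centred at [y0], hence
    bounded, convex, and closed when [C] is; as [k]
    grows, [k + 1] grows and there are fewer bad points, hence the [S k]
    increase.

    A point of [S k `&` U] is never bad ([ball_core_le]): being bad is an open
    condition, so a bad point other than [y0] could be moved slightly towards
    [y0] and stay bad, which gives a bad point strictly closer to [y0]; and [y0]
    itself is not bad.  The criterion thus applies on [S k `&` U].

    A point [x] of [C] lies in [S k] for large [k], because [f''] is bounded on
    the points of [C `&` U] closer to [y0] than [x], so that none of them is bad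
    once [lam k] exceeds this bound.  Finally, [f''] is continuous at [y0], so
    bad points keep a positive distance from [y0], and [S k] contains a
    neighbourhood of [y0] in [C]: this yields a second point ([ball_core_neq]). *)

Section ConvexSets.
Context {R : realType} {X : normedModType R}.
Implicit Types (A C : set X) (x y p v : X).

(** Convex combinations live on an alias of the vector space and are indexed by a
    bundled type of weights, which gets in the way of computing with norms and
    derivatives; here the segment is an affine function of a real number. *)
Lemma convex_setP A :
  convex_set A <->
  forall x y (t : R), A x -> A y -> 0 <= t <= 1 -> A (x + t *: (y - x)).
Proof.
have convE x y (k : {i01 R}) :
    x + k%:num *: (y - x) = conv k (y : convex_lmodType X) x.
  rewrite [RHS]/(k%:num *: y + (1 - k%:num) *: x).
  by rewrite scalerBr scalerBl scale1r addrCA.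
split=> [Ac x y t Ax Ay /andP[t0 t1]|Ac y x k /set_mem Ay /set_mem Ax].
  apply/set_mem; rewrite (convE x y (Itv01 t0 t1)); apply: Ac.
    exact: mem_set.
  exact: mem_set.
by apply/mem_set; rewrite -convE; apply: Ac; rewrite // ge0 le1.
Qed.

(** With both endpoints of [0, 1] excluded, a nonzero [v] gives a new point that
    differs from [p] and is strictly closer to [p + v]. *)
Lemma near_segment (P : set X) p v :
  (\forall x \near p, P x) -> exists t : R, 0 < t < 1 /\ P (p + t *: v).
Proof.
move=> Pp.
have line_cvg : p + t *: v @[t --> (0 : R)^'+] --> p.
  rewrite -[X in _ --> X]addr0 -[X in _ --> _ + X](scale0r v).
  apply: cvg_at_right_filter; apply: cvgD; first exact: cvg_cst.
  by apply: cvgZr_tmp; exact: cvg_id.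
near ((0 : R)^'+) => t.
exists t; split; last by near: t; exact: line_cvg.
by apply/andP; split; near: t; [exact: nbhs_right_gt|exact: nbhs_right_lt].
Unshelve. all: by end_near. Qed.

(** The infimum of a nonempty [E] would give the same set, but intersecting over
    all radii in [E] avoids discussing that infimum and whether it is attained. *)
Definition ball_core C y (E : set R) : set X :=
  C `&` [set x | forall r, E r -> `|x - y| <= r].

Lemma ball_core_convex C y E : convex_set C -> convex_set (ball_core C y E).
Proof.
move=> /convex_setP Cc; apply/convex_setP => a b t [Ca aE] [Cb bE] t01.
split=> [|r Er]; first exact: Cc.
have /andP[t0 t1] := t01.
have -> : a + t *: (b - a) - y = (1 - t) *: (a - y) + t *: (b - y).
  have -> : b - a = (b - y) - (a - y) by rewrite opprB addrA subrK.
  by rewrite addrAC scalerBr scalerBl scale1r [t *: _ - _]addrC addrA.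
rewrite (le_trans (ler_normD _ _))// !normrZ !ger0_norm ?subr_ge0//.
rewrite (@le_trans _ _ ((1 - t) * r + t * r))//; last first.
  by rewrite -mulrDl subrK mul1r.
by rewrite lerD// ler_wpM2l ?subr_ge0// ?aE ?bE.
Qed.

Lemma ball_core_closed C y E : closed C -> closed (ball_core C y E).
Proof.
move=> Ccl; apply: closedI => //.
rewrite (_ : mkset _ = \bigcap_(r in E) [set x | `|x - y| <= r]); last first.
  by apply/seteqP; split=> x xE r Er; exact: xE.
apply: closed_bigI => r _.
apply: (@closed_comp _ _ (fun x => `|x - y|) [set s | s <= r]).
  by move=> x _; apply: cvg_norm; apply: cvgB; [exact: cvg_id|exact: cvg_cst].
exact: closed_le.
Qed.

Lemma ball_core_bounded C y E r : E r -> bounded_set (ball_core C y E).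
Proof.
move=> Er; exists (r + `|y|); split=> [|M rM x [_ xE]]; first exact: num_real.
apply: le_trans (ltW rM); rewrite -[x in `|x|](subrK y) (le_trans (ler_normD _ _))//.
by rewrite lerD2r xE.
Qed.

(** The radii in [E] exclude every point farther from [y0] than some point [z]
    with [lam < h z].  Were [h x] above [lam] at a point [x] of the core, then by
    continuity it would be so at a point of the segment towards [y0] as well,
    and that point is strictly closer to [y0] unless [x = y0]. *)
Lemma ball_core_le (C U : set X) (h : X -> R) y0 (lam : R) (E : set R) :
  convex_set C -> open U -> (forall x, U x -> h z @[z --> x] --> h x) ->
  C y0 -> h y0 <= lam ->
  (forall z, (C `&` U) z -> lam < h z -> E `|z - y0|) ->
  forall x, (ball_core C y0 E `&` U) x -> h x <= lam.
Proof.
move=> /convex_setP Cseg Uo hcont Cy0 hy0 Ebad x [[Cx xE] Ux].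
rewrite leNgt; apply/negP => lamhx.
have [|t [/andP[t0 t1] [Uz lamhz]]] :=
    @near_segment (U `&` [set z | lam < h z]) x (y0 - x).
  by apply: filterI; [exact: open_nbhs_nbhs|exact: cvgr_gt (hcont x Ux) _ lamhx].
have Cz : C (x + t *: (y0 - x)) by apply: Cseg; rewrite // !ltW.
have zE : x + t *: (y0 - x) - y0 = (1 - t) *: (x - y0).
  by rewrite -[y0 - x]opprB scalerN addrAC scalerBl scale1r.
have : `|x - y0| <= `|x + t *: (y0 - x) - y0| by apply: xE; exact: Ebad.
rewrite zE normrZ gtr0_norm ?subr_gt0//.
rewrite -subr_ge0 mulrBl mul1r addrAC subrr add0r oppr_ge0 pmulr_rle0//.
rewrite normr_le0 subr_eq0 => /eqP xy0.
by move: lamhx; rewrite xy0 ltNge hy0.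
Qed.

(** When the radii are bounded away from 0, the core contains all points of [C]
    near [y0], in particular those at the start of the segment from [y0] to
    another point of [C]. *)
Lemma ball_core_neq (C U : set X) y0 c (E : set R) (d : R) :
  convex_set C -> open U -> U y0 -> C y0 -> C c -> c != y0 ->
  0 < d -> (forall r, E r -> d <= r) ->
  exists2 x, (ball_core C y0 E `&` U) x & x != y0.
Proof.
move=> /convex_setP Cseg Uo Uy0 Cy0 Cc cy0 d0 dE.
have [|t [/andP[t0 t1] [near_y0 Ux]]] :=
    @near_segment (ball y0 d `&` U) y0 (c - y0).
  by apply: filterI; [exact: nbhsx_ballx|exact: open_nbhs_nbhs].
exists (y0 + t *: (c - y0)).
  split=> //; split=> [|r /dE dr]; first by apply: Cseg; rewrite // !ltW.
  apply: le_trans dr; apply: ltW.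
  by move: near_y0; rewrite -ball_normE/= distrC.
by rewrite -subr_eq0 addrC addKr scaler_eq0 subr_eq0 negb_or cy0 gt_eqF.
Qed.

End ConvexSets.

Section Evaluation.
Context {R : realType} {V W : normedModType R}.

(** Evaluation gets a name so that it can carry the linear structure through which
    it is its own differential. *)
Definition contlin_eval (v : V) (h : contlin V W) : W := h v.

Fact contlin_eval_linear v : linear (contlin_eval v).
Proof. by []. Qed.

HB.instance Definition _ v :=
  GRing.isLinear.Build R (contlin V W) W _ (contlin_eval v)
    (contlin_eval_linear v).

Lemma contlin_eval_continuous v : continuous (contlin_eval v).
Proof.
apply/linear_bounded_continuous/linear_boundedP.
exists `|v|; split=> [|M vM h]; first exact: num_real.
rewrite (le_trans (ler_opnorm h v))// mulrC ler_wpM2r ?opnorm_ge0//.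
exact: ltW.
Qed.

End Evaluation.

(** The mean value theorem holds for real-valued functions only.  As the norm of
    a functional is the supremum of its values at the vectors [v] of the unit
    ball, it is enough to apply that theorem, for each such [v], to the real
    function [t |-> g (y + t (x - y)) v]. *)
Lemma contlin_mean_value {R : realType} {V V' : normedModType R}
    (g : V -> contlin V' R) (A : set V) (L : R) :
  convex_set A -> (forall x, A x -> differentiable g x) ->
  (forall x, A x -> `|frechet g x| <= L) -> L.-lipschitz_A g.
Proof.
move=> /convex_setP Ac gd gL -[x y] [/= Ax Ay].
pose c t := y + t *: (x - y).
have Ac01 (t : R) : 0 <= t <= 1 -> A (c t) by move=> t01; exact: Ac.
apply: opnorm_leP => v v1.
pose phi t := contlin_eval v (g (c t)).
pose dphi t := frechet g (c t) (x - y) v.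
have phiD (t : R) : 0 <= t <= 1 -> is_diff t phi (fun s => s *: dphi t).
  move=> t01.
  have cD : is_diff t c (fun s => s *: (x - y)).
    have := is_diffD (is_diff_cst y t) (is_diff_scalel t (x - y)).
    by rewrite add0r.
  have gD : is_diff (c t) g (frechet g (c t)).
    by apply: DiffDef; [exact/gd/Ac01|rewrite frechetE//; exact/gd/Ac01].
  have eD : is_diff (g (c t)) (contlin_eval v) (contlin_eval v).
    have ec := @contlin_eval_continuous R V' R v.
    by apply: DiffDef; [exact: linear_differentiable|exact: diff_lin].
  have := is_diff_comp (is_diff_comp cD gD) eD.
  have -> // : contlin_eval v \o (frechet g (c t) \o (fun s => s *: (x - y)))
    = (fun s : R => s *: dphi t).
  by apply/funext => s /=; rewrite linearZ.
have phi'E (t : R) : 0 <= t <= 1 -> is_derive t 1 phi (dphi t).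
  move=> t01; have pD := phiD t t01.
  apply: DeriveDef; first exact/diff_derivable.
  by rewrite deriveE// diff_val scale1r.
have [||t] := @MVT_segment R phi dphi 0 1 ler01.
- by move=> t; rewrite in_itv/= => /andP[/ltW t0 /ltW t1]; apply: phi'E; rewrite t0.
- apply: derivable_within_continuous => t; rewrite in_itv/= => t01.
  by have [] := phi'E t t01.
rewrite in_itv/= => t01.
have c0 : c 0 = y by rewrite /c scale0r addr0.
have c1 : c 1 = x by rewrite /c scale1r addrC subrK.
rewrite /phi c0 c1 subr0 mulr1 => phiE.
rewrite [X in `|X|](_ : _ = dphi t)//.
rewrite (le_trans (ler_opnorm _ _))//.
rewrite (@le_trans _ _ (opnorm (frechet g (c t) (x - y))))//.
  by rewrite ler_piMr// opnorm_ge0.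
apply: (le_trans (ler_opnorm (frechet g (c t)) (x - y))).
apply: ler_wpM2r => //; exact/gL/Ac01.
Qed.

Theorem corollary6p1 (R : realType) (X : normedModType R)
    (hX : exists x : X, x != 0)
    (U : set X) (hUo : open U) (hUc : convex_set U)
    (f : X -> R) (hf : C2_on f U)
    (C : set X) (hC : convex_set C) (hCU : C `&` U !=set0)
    (hf'' : forall B : set X, bounded_set B -> B `<=` C `&` U ->
      [bounded frechet (frechet f) x | x in B] /\
      unif_continuous_on B (frechet (frechet f)))
    (y0 : X) (hy0 : (C `&` U) y0) :
  let s : \bar R :=
    ereal_sup [set (`|frechet (frechet f) x|)%:E | x in C `&` U] in
  let s0 : R := `|frechet (frechet f) y0| in
  (s = +oo%E ->
    forall lam : nat -> R,
      increasing_seq lam -> (forall k, 0 < lam k) ->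
      s0 < lam 0%N -> lam k @[k --> \oo] --> +oo ->
      exists S : nat -> set X,
        (forall k, S k `<=` S k.+1) /\
        (forall k, [/\ bounded_set (S k), convex_set (S k) & S k `<=` C]) /\
        (closed C -> forall k, closed (S k)) /\
        (forall k, S k `&` U !=set0) /\
        \bigcup_k S k = C /\
        (forall k, (lam k).-lipschitz_(S k `&` U) (frechet f)) /\
        ((exists x y, [/\ C x, C y & x != y]) ->
          forall k, exists x y, [/\ (S k `&` U) x, (S k `&` U) y & x != y]))
  /\
  ((s < +oo)%E -> (fine s).-lipschitz_(C `&` U) (frechet f)).
Proof.
move=> s s0; have [_ f'D f''C] := hf; have [Cy0 Uy0] := hy0.
have /convex_setP Useg := hUc.
have convI (A : set X) : convex_set A -> convex_set (A `&` U).
  move=> /convex_setP Aseg; apply/convex_setP => x y t [Ax Ux] [Ay Uy] t01.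
  by split; [exact: Aseg|exact: Useg].
pose h x := `|frechet (frechet f) x|.
have hcont x : U x -> h z @[z --> x] --> h x.
  by move=> Ux; apply: cvg_norm; exact: f''C.
split=> [_ lam lam_incr _ s0lam lam_oo|s_fin]; last first.
  apply: contlin_mean_value; [exact: convI|by move=> x [_ /f'D]|move=> x xCU].
  have hs : ((h x)%:E <= s)%E by apply: ereal_sup_ubound; exists x.
  rewrite -lee_fin fineK// fin_real// s_fin andbT.
  by rewrite (lt_le_trans _ hs)// ltNyr.
(* The radius k + 1 keeps the core bounded even when there are no bad points. *)
pose E k := k.+1%:R |` [set `|z - y0| | z in C `&` U `&` [set z | lam k < h z]].
pose S k := ball_core C y0 (E k).
have lam0 k : s0 < lam k by rewrite (lt_le_trans s0lam)// lam_incr.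
have Sy0 k : (S k `&` U) y0.
  by split=> //; split=> // r; rewrite subrr normr0 => -[->|[z _ <-]].
have S_h k x : (S k `&` U) x -> h x <= lam k.
  apply: ball_core_le => //; first exact/ltW/lam0.
  by move=> z CUz lamz; right; exists z.
exists S; split; [|split; [|split; [|split; [|split; [|split]]]]].
- move=> k x [Cx xE]; split=> // r [->|[z [CUz lamz] <-]].
    by rewrite (le_trans (xE k.+1%:R _))//; [left|rewrite ler_nat].
  apply: xE; right; exists z => //; split=> //=.
  by rewrite (le_lt_trans _ lamz)// lam_incr.
- move=> k; split; [|exact: ball_core_convex|by move=> x []].
  by apply: (@ball_core_bounded _ _ _ _ _ k.+1%:R); left.
- by move=> Ccl k; exact: ball_core_closed.
- by move=> k; exists y0.
- apply/seteqP; split=> [x [k _ []]//|x Cx].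
  (* A bad point that keeps x out of S k is closer to y0 than x, hence in B, where
     the second derivative is bounded. *)
  pose B := ball_core (C `&` U) y0 [set `|x - y0|].
  have [] := hf'' B (@ball_core_bounded _ _ _ _ _ `|x - y0| erefl).
    by move=> z [].
  move=> [M [_ hM]] _.
  have [k _ kP] : \forall k \near \oo, (M + 1 <= lam k) && (`|x - y0| <= k.+1%:R).
    near=> k; apply/andP; split; near: k.
      exact: (iffLR (cvgryPge _) lam_oo).
    have := nbhs_infty_ger `|x - y0|; apply: filterS => k /le_trans; apply.
    by rewrite ler_nat.
  have /andP[Mk xk] := kP k (leqnn k).
  exists k => //; split=> // r [->//|[z [CUz lamz] <-]].
  rewrite leNgt; apply/negP => zx.
  have : h z <= M + 1.
    by apply: hM; [rewrite ltrDl|split=> // _ ->; exact: ltW].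
  by rewrite leNgt (le_lt_trans Mk lamz).
- move=> k; apply: contlin_mean_value => //; last exact: S_h.
    exact/convI/ball_core_convex.
  by move=> x [_ /f'D].
- move=> [a [b [Ca Cb ab]]] k.
  have [c Cc cy0] : exists2 c, C c & c != y0.
    by have [ay0|] := eqVneq a y0; [exists b; rewrite // -ay0 eq_sym|exists a].
  have /nbhs_ballP[d /= d0 dlam] : \forall z \near y0, h z < lam k.
    by apply: cvgr_lt (hcont y0 Uy0) _ _; exact: lam0.
  have [||x Sx xy0] := @ball_core_neq _ _ C U y0 c (E k) (Num.min 1 d) hC hUo
    Uy0 Cy0 Cc cy0; first by rewrite lt_min ltr01.
    move=> r [->|[z [_ lamz] <-]]; rewrite ge_min ?ler1n//.
    apply/orP; right; rewrite leNgt; apply/negP => zd.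
    have : h z < lam k by apply: dlam; rewrite -ball_normE/= distrC.
    by rewrite ltNge ltW.
  by exists x, y0; split=> //; exact: Sy0.
Unshelve. all: by end_near. Qed.
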